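(* For every integer $n\ge 1$, $$C_n(a,b;t)=C_{n-1}(a,b;t)+a^{n-1}t\sum_{k=1}^{n-1} b^{k}\, C_k(a,b;t)\, C_{n-k-1}\big(a,b;(ab)^k t\big).$$
   Context: A Dyck path of semilength $n$ is a word $P=s_1\ldots s_{2n}$ consisting of $n$ letters $0$ (up steps) and $n$ letters $1$ (down steps) such that every prefix contains at least as many $0$'s as $1$'s; let $\mathcal D_n$ be the set of these ($\mathcal D_0$ contains only the empty word). The descent set is $\mathrm{Des}\,P=\{i: s_i=1,\ s_{i+1}=0\}$ and $\mathrm{des}\,P=\#\mathrm{Des}\,P$. For $1\le i\le 2n$ let $|s_1\ldots s_i|_0$ and $|s_1\ldots s_i|_1$ denote the number of $0$'s and of $1$'s in the prefix $s_1\ldots s_i$. Put $\alpha(P)=\sum_{i\in\mathrm{Des}\,P}|s_1\ldots s_i|_0$ and $\beta(P)=\sum_{i\in\mathrm{Des}\,P}|s_1\ldots s_i|_1$. Define the polynomial $C_n(a,b;t)=\sum_{P\in\mathcal D_n}a^{\alpha(P)}b^{\beta(P)}t^{\mathrm{des}\,P}$; in particular $C_0(a,b;t)=1$. The notation $C_m(a,b;u)$ means this polynomial with $t$ replaced by $u$. *)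

(* Defs.v *)
From HB Require Import structures.
From mathcomp Require Import all_boot all_order all_algebra.
From mathcomp Require Import mpoly.
Set Implicit Arguments.
Unset Strict Implicit.
Unset Printing Implicit Defensive.
Import GRing.Theory.

(* Words over {0, 1} are sequences of booleans: false is the letter 0 (an up
   step), true is the letter 1 (a down step). *)
Section Words.
Implicit Types s : seq bool.

(* Positions in words are 1-based. *)
Definition letter s (i : nat) : bool := nth false s i.-1.

(* zeros s i = |s_1 ... s_i|_0 and ones s i = |s_1 ... s_i|_1 *)
Definition zeros s (i : nat) : nat := count_mem false (take i s).
Definition ones s (i : nat) : nat := count_mem true (take i s).

Definition is_dyck (n : nat) s : bool :=
  [&& count_mem false s == n, count_mem true s == n &
      all (fun i => ones s i <= zeros s i) (iota 0 (size s).+1)].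

(* The descents i range over 1 <= i < size s, so that s_(i+1) exists. *)
Definition Des s : seq nat :=
  [seq i <- index_iota 1 (size s) | letter s i && ~~ letter s i.+1].

Definition des s : nat := size (Des s).

Definition dyck_alpha s : nat := \sum_(i <- Des s) zeros s i.
Definition dyck_beta s : nat := \sum_(i <- Des s) ones s i.

End Words.

Definition dyck_paths (n : nat) : {set (2 * n).-tuple bool} :=
  [set P : (2 * n).-tuple bool | is_dyck n P].

Local Open Scope ring_scope.

Definition va : {mpoly int[3]} := 'X_(inord 0).
Definition vb : {mpoly int[3]} := 'X_(inord 1).
Definition vt : {mpoly int[3]} := 'X_(inord 2).

Definition dyck_poly (n : nat) : {mpoly int[3]} :=
  \sum_(P in dyck_paths n)
    va ^+ dyck_alpha P * vb ^+ dyck_beta P * vt ^+ des P.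

(* dyck_poly n is C_n(a, b; t); this is C_n(a, b; u), with u substituted for t. *)
Definition dyck_poly_at (n : nat) (u : {mpoly int[3]}) : {mpoly int[3]} :=
  dyck_poly n \mPo [tuple va; vb; u].

(* Main.v *)
Require Import Defs.
From HB Require Import structures.
From mathcomp Require Import all_boot all_order all_algebra.
From mathcomp Require Import mpoly ring zify.
Set Implicit Arguments.
Unset Strict Implicit.
Unset Printing Implicit Defensive.
Import GRing.Theory.
Local Open Scope ring_scope.

(** Record a Dyck path of semilength n by two subsets of {1, ..., n-1}: Z, the
    numbers |s_1...s_i|_0, and O, the numbers |s_1...s_i|_1, at its descents i.
    Reading the positions x = 1, ..., n-1 in turn, x in O as a rise of weight
    b^x t and x in Z as a fall of weight a^x gives a bicoloured Motzkin path, so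
    C_n is the weight of the closed Motzkin paths of length n-1.  The last step
    of such a path is flat and outside both sets (C_{n-1}), flat and in both
    (the term k = n-1), or a fall, matched with a rise at some k < n-1; in that
    case the part before k gives C_k and the part strictly between them, with
    positions shifted by k, gives C_{n-k-1} at (ab)^k t.

    Motzkin paths are counted by polynomials whose coefficient of X^h is the
    weight of the paths ending at height h. *)

(* Position z lies in neither set, in O only, or, through the second summand,
   also in Z; drop_poly 1 forbids going below height 0. *)
Definition step (R : comNzRingType) (a b t : R) (z : nat) (p : {poly R}) :=
  let q := (1 + (b ^+ z * t) *: 'X) * p in q + a ^+ z *: drop_poly 1 q.

Fixpoint walk (R : comNzRingType) (a b t : R) (z m : nat) (p : {poly R}) :=
  if m is m'.+1 then step a b t (z + m') (walk a b t z m' p) else p.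

(** * Decompositions of weighted Motzkin paths *)

Section Walk.
Variables (R : comNzRingType) (a b t : R).
Implicit Types (z m i k o : nat) (p q : {poly R}).

Lemma coef_step z p i :
  (step a b t z p)`_i = p`_i + b ^+ z * t * (if i is i'.+1 then p`_i' else 0)
                        + a ^+ z * (p`_i.+1 + b ^+ z * t * p`_i).
Proof.
rewrite /step mulrDl mul1r -scalerAl coefD coefZ coef_drop_poly addn1 !coefD.
by rewrite !coefZ !coefXM; case: i.
Qed.

Lemma step_linear z c p q :
  step a b t z (c *: p + q) = c *: step a b t z p + step a b t z q.
Proof. by apply/polyP=> -[|i]; rewrite !(coefD, coefZ, coef_step); ring. Qed.

Lemma walkSl z m p :
  walk a b t z m.+1 p = walk a b t z.+1 m (step a b t z p).
Proof.
elim: m => [|m IHm] /=; first by rewrite addn0.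
by rewrite -IHm /= addnS.
Qed.

Lemma walk_linear z m c p q :
  walk a b t z m (c *: p + q) = c *: walk a b t z m p + walk a b t z m q.
Proof. by elim: m => //= m ->; rewrite step_linear. Qed.

Lemma walkD z m p q :
  walk a b t z m (p + q) = walk a b t z m p + walk a b t z m q.
Proof. by rewrite -[p]scale1r walk_linear !scale1r. Qed.

Lemma walk0 z m : walk a b t z m 0 = 0.
Proof. by have /eqP := walkD z m 0 0; rewrite addr0 eq_sym -subr_eq0 addrK => /eqP. Qed.

Lemma walkZ z m c p : walk a b t z m (c *: p) = c *: walk a b t z m p.
Proof. by rewrite -[c *: p]addr0 walk_linear walk0 addr0. Qed.

(** Paths at positive height, lowered by one, step as usual; a rise from height 0 also brings in new
    ones, and these form the constant. *)
Lemma drop_step z p :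
  drop_poly 1 (step a b t z p)
  = step a b t z (drop_poly 1 p) + (b ^+ z * t * p`_0)%:P.
Proof.
apply/polyP=> -[|i]; rewrite coefD coefC !(coef_drop_poly, coef_step) !addn1 /=; ring.
Qed.

(* Last-passage decomposition: a path ending at positive height is cut at its
   last step from height 0 to height 1. *)
Lemma drop_walk m :
  drop_poly 1 (walk a b t 1 m 1)
  = \sum_(1 <= k < m.+1)
      ((walk a b t 1 k.-1 1)`_0 * b ^+ k * t) *: walk a b t k.+1 (m - k) 1.
Proof.
elim: m => [|m IHm].
  by rewrite big_geq //=; apply/polyP=> i; rewrite coef_drop_poly coef1 coef0 addn1.
rewrite [LHS]drop_step IHm [RHS]big_nat_recr //= subnn add1n; congr (_ + _).
  have stepD p q : step a b t m.+1 (p + q) = step a b t m.+1 p + step a b t m.+1 q.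
    by rewrite -[p]scale1r step_linear !scale1r.
  have step0 : step a b t m.+1 0 = 0 by have := walk0 m.+1 1; rewrite /= addn0.
  rewrite (big_morph _ stepD step0) !big_seq; apply: eq_bigr => k.
  rewrite mem_index_iota => /andP[k1 km].
  have -> : (m.+1 - k = (m - k).+1)%N by lia.
  rewrite /= (_ : (k.+1 + (m - k))%N = m.+1); last by lia.
  by rewrite -[X in step _ _ _ _ X]addr0 step_linear step0 addr0.
by rewrite -alg_polyC; congr (_ *: _); ring.
Qed.

Lemma walk_return m :
  (walk a b t 1 m.+1 1)`_0
  = (walk a b t 1 m 1)`_0
    + a ^+ m.+1 * t * \sum_(1 <= k < m.+2)
        b ^+ k * (walk a b t 1 k.-1 1)`_0 * (walk a b t k.+1 (m.+1 - k).-1 1)`_0.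
Proof.
have /(congr1 (fun p : {poly R} => p`_0)) := drop_walk m.
rewrite coef_drop_poly coef_sum /= coef_step => ->.
(* The top term [k = m.+1] is the flat step in both sets; its inner walk is empty. *)
rewrite mulr0 addr0 add1n [in RHS]big_nat_recr //= subnn /= coef1 mulr1.
congr (_ + _).
rewrite -[RHS]mulrA; congr (_ * _); rewrite mulrDr; congr (_ + _); last by ring.
rewrite mulr_sumr !big_seq; apply: eq_bigr => k.
rewrite mem_index_iota => /andP[k1 km].
by rewrite coefZ (_ : (m.+1 - k).-1 = (m - k)%N); [ring | lia].
Qed.

End Walk.

(* Shifting all positions by k multiplies each rise by b^k and each fall by
   a^k; on closed paths only the product (ab)^k per pair is visible. *)
Lemma walk_shift (R : comNzRingType) (a b t : R) k m i :
  (walk a b ((a * b) ^+ k * t) 1 m 1)`_i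
  = a ^+ (k * i) * (walk a b t k.+1 m 1)`_i.
Proof.
(* At height [i] there are [i] unmatched rises, each keeping a factor [a ^+ k] that no fall has
   absorbed yet. *)
elim: m i => [|m IHm] i /=.
  by rewrite coef1; case: i => [|i]; rewrite ?muln0 ?expr0 ?mul1r ?mulr0.
rewrite !coef_step; case: i => [|i]; rewrite !IHm ?muln0 ?muln1 ?mulnS !exprD !exprS exprMn; ring.
Qed.

Lemma walk_morph (R S : comNzRingType) (f : {rmorphism R -> S}) (a b t : R) z m i :
  f (walk a b t z m 1)`_i = (walk (f a) (f b) (f t) z m 1)`_i.
Proof.
elim: m i => [|m IHm] i /=; first by rewrite !coef1 rmorph_nat.
by rewrite !coef_step; case: i => [|i]; rewrite !(rmorphD, rmorphM, rmorphXn, rmorph0) /= !IHm.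
Qed.

(** * Completions of a Dyck word as Motzkin paths *)

Section Completion.
Variables (R : comNzRingType) (a b t : R) (n : nat).

Definition rises o z : {poly R} := \prod_(o <= i < z) (1 + (b ^+ i * t) *: 'X).

(* At a point of a Dyck word with z letters 0 and o letters 1, membership in Z is
   settled below z, but membership in O only up to o (below o after a 1): the
   product rises sums over the undecided subset of O, and the Motzkin path goes
   on from position z.  These are the weights of all completions of the word
   according to its last letter. *)
Definition after_up z o : R := (walk a b t z (n - z) (rises o.+1 z))`_0.

Definition after_down z o : R :=
  if (z < n)%N
  then a ^+ z * (walk a b t z.+1 (n - z.+1) (drop_poly 1 (rises o z.+1)))`_0
  else 1.

(** The next letter decides whether [z] is in Z: a 0 leaves it out, a 1 forces a descent before the
    next 0. These are the two summands of [step]. *)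
Lemma after_up_rec z o : (o < z)%N -> (z < n)%N ->
  after_up z o = after_up z.+1 o + after_down z o.+1.
Proof.
move=> oz zn; rewrite /after_up /after_down zn.
rewrite (_ : (n - z = (n - z.+1).+1)%N); last by lia.
rewrite walkSl /step -(mulrC (rises _ _)) -big_nat_recr //.
by rewrite walkD walkZ coefD coefZ.
Qed.

(** No fall is left, so the constant coefficient keeps only the empty choice of rises. *)
Lemma after_up_end z o : (n <= z)%N -> after_up z o = 1.
Proof.
move=> nz; rewrite /after_up (_ : (n - z = 0)%N) //=; last by lia.
rewrite /rises; elim/big_ind: _ => [|p q p0 q0|i _]; first by rewrite coef1.
  by rewrite coefM big_ord1 p0 q0 mulr1.
by rewrite coefD coefZ coef1 coefX mulr0 addr0.
Qed.

(** The next letter decides whether [o] is in O, which is the choice in the factor [i = o] of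
    [rises]: a 0 completes a descent, a 1 leaves [o] out. *)
Lemma after_down_rec z o : (o <= z)%N -> (z < n)%N ->
  after_down z o = a ^+ z * b ^+ o * t * after_up z.+1 o + after_down z o.+1.
Proof.
move=> oz zn; rewrite /after_up /after_down zn.
rewrite {1}/rises big_ltn // -/(rises _ _).
have -> : drop_poly 1 ((1 + (b ^+ o * t) *: 'X) * rises o.+1 z.+1)
  = (b ^+ o * t) *: rises o.+1 z.+1 + drop_poly 1 (rises o.+1 z.+1).
  apply/polyP=> i; rewrite mulrDl mul1r -scalerAl.
  by rewrite !(coef_drop_poly, coefD, coefZ, coefXM) !addn1 addrC.
by rewrite walk_linear coefD coefZ; ring.
Qed.

(** The empty product has no rise to match the fall at [z]. This stands for the illegal down step
    from the diagonal. *)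
Lemma after_down_out z : (z < n)%N -> after_down z z.+1 = 0.
Proof.
move=> zn; rewrite /after_down zn /rises big_geq //.
by rewrite drop_poly_eq0 ?size_poly1 // walk0 coef0 mulr0.
Qed.

Lemma after_down_end z o : (n <= z)%N -> after_down z o = 1.
Proof. by rewrite /after_down ltnNge => ->. Qed.

End Completion.

(** * Descents of a word extended by one letter *)

Lemma Des_rcons s x :
  Des (rcons s x) = if last false s && ~~ x then rcons (Des s) (size s) else Des s.
Proof.
have letter_rcons i : (0 < i <= size s)%N -> letter (rcons s x) i = letter s i.
  by move=> i_s; rewrite /letter nth_rcons (_ : (i.-1 < size s)%N) //; lia.
case: (posnP (size s)) => [/size0nil -> //|s_gt0].
have iotaE : iota 1 (size s) = iota 1 (size s).-1 ++ [:: size s].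
  by rewrite -[in LHS](prednK s_gt0) -[_.-1.+1]addn1 iotaD add1n prednK.
rewrite {1}/Des size_rcons /index_iota subn1 iotaE filter_cat /=.
rewrite letter_rcons ?s_gt0 //=.
have -> : letter s (size s) = last false s by rewrite /letter nth_last.
have -> : letter (rcons s x) (size s).+1 = x by rewrite /letter nth_rcons ltnn eqxx.
have -> : [seq i <- iota 1 (size s).-1
            | letter (rcons s x) i && ~~ letter (rcons s x) i.+1] = Des s.
  rewrite /Des /index_iota subn1; apply: eq_in_filter => i.
  by rewrite mem_iota => i_s; rewrite !letter_rcons //; lia.
by case: ifP => _; rewrite ?cats0 ?cats1.
Qed.

Lemma dyck_sum_rcons (c : seq bool -> nat -> nat) s x :
  (forall i, (i <= size s)%N -> c (rcons s x) i = c s i) ->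
  \sum_(i <- Des (rcons s x)) c (rcons s x) i
  = (\sum_(i <- Des s) c s i + (last false s && ~~ x) * c s (size s))%N.
Proof.
move=> c_rcons; have c_Des : \sum_(i <- Des s) c (rcons s x) i = \sum_(i <- Des s) c s i.
  rewrite !big_seq; apply: eq_bigr => i; rewrite mem_filter mem_index_iota.
  by move=> /and3P[_ _ /ltnW /c_rcons].
rewrite Des_rcons; case: ifP => _; rewrite ?mul0n ?addn0 //.
by rewrite big_rcons /= c_Des c_rcons // mul1n.
Qed.

Lemma take_rcons_le s (x : bool) i : (i <= size s)%N -> take i (rcons s x) = take i s.
Proof. by move=> i_s; rewrite -cats1 takel_cat. Qed.

(** * Summing over Dyck words with a given prefix *)

Section Words.
Variables (R : comNzRingType) (a b t : R) (n : nat).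
Implicit Types s : seq bool.

Definition dyck_weight s : R := a ^+ dyck_alpha s * b ^+ dyck_beta s * t ^+ des s.

Lemma dyck_weight_rcons s x :
  dyck_weight (rcons s x) = dyck_weight s *
    (if last false s && ~~ x
     then a ^+ count_mem false s * b ^+ count_mem true s * t else 1).
Proof.
rewrite /dyck_weight /dyck_alpha /dyck_beta !dyck_sum_rcons; try first
  [by move=> i i_s; rewrite /ones take_rcons_le | by move=> i i_s; rewrite /zeros take_rcons_le].
rewrite /des Des_rcons /zeros /ones take_size.
case: ifP => _; last by rewrite !addn0 mulr1.
by rewrite size_rcons !mul1n !exprD exprS; ring.
Qed.

Definition completions s l : R :=
  \sum_(w : l.-tuple bool | is_dyck n (s ++ w)) dyck_weight (s ++ w).

Lemma completions0 s :
  completions s 0 = if is_dyck n s then dyck_weight s else 0.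
Proof.
rewrite /completions (eq_bigl (fun w : 0.-tuple bool => (w == [tuple]) && is_dyck n s)).
  case: (is_dyck n s); last by rewrite big_pred0 // => w; rewrite andbF.
  under eq_bigl do rewrite andbT.
  by rewrite big_pred1_eq cats0.
by move=> w; rewrite tuple0 cats0 eqxx.
Qed.

Lemma completionsS s l :
  completions s l.+1 = completions (rcons s false) l + completions (rcons s true) l.
Proof.
rewrite /completions.
rewrite (reindex (fun p : bool * l.-tuple bool => [tuple of p.1 :: p.2])) /=; last first.
  exists (fun w : l.+1.-tuple bool => (thead w, behead_tuple w)) => [[x w] _|w _] /=.
    by congr (_, _); apply: val_inj.
  by rewrite [RHS]tuple_eta; apply: val_inj.
rewrite -(pair_big_dep xpredT (fun x (w : l.-tuple bool) => is_dyck n (s ++ x :: w))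
            (fun x (w : l.-tuple bool) => dyck_weight (s ++ x :: w))) /=.
rewrite big_bool addrC /=; under eq_bigl do rewrite -cat_rcons.
under eq_bigr do rewrite -cat_rcons.
congr (_ + _); under eq_bigl do rewrite -cat_rcons.
by under eq_bigr do rewrite -cat_rcons.
Qed.

Definition ballot s := all (fun i => ones s i <= zeros s i)%N (iota 0 (size s).+1).

Lemma ballot_rcons s x : ballot (rcons s x) =
  ballot s && (count_mem true s + x <= count_mem false s + ~~ x)%N.
Proof.
rewrite /ballot size_rcons -[(size s).+2]addn1 iotaD all_cat [all _ (iota (0 + _) 1)]/= andbT.
congr (_ && _).
  apply: eq_in_all => i; rewrite mem_iota => i_s.
  by rewrite /ones /zeros take_rcons_le //; lia.
by rewrite /ones /zeros -(size_rcons s x) take_size -!cats1 !count_cat /=; case: x; rewrite !addn0.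
Qed.

Lemma completions_out s l :
  ~~ ballot s || (n < count_mem false s)%N -> completions s l = 0.
Proof.
move=> bad; apply: big_pred0 => w; apply/negP => /and3P[/eqP w0 /eqP w1 /allP w_dyck].
case/orP: bad => [/allP[i i_s]|]; last by move: w0; rewrite count_cat; lia.
have := w_dyck i; rewrite /ones /zeros takel_cat; last by move: i_s; rewrite mem_iota; lia.
by apply; move: i_s; rewrite !mem_iota size_cat; lia.
Qed.

Lemma count_letters s : (count_mem false s + count_mem true s)%N = size s.
Proof. by rewrite -(count_predC (pred1 false) s); congr (_ + _)%N; apply: eq_count; case. Qed.

Lemma ballot_count s : ballot s -> (count_mem true s <= count_mem false s)%N.
Proof.
by move=> /allP/(_ (size s)); rewrite /ones /zeros take_size mem_iota; apply; rewrite leq0n /=.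
Qed.

Lemma ballot_last_up s : (0 < size s)%N -> ballot s -> ~~ last false s ->
  (count_mem true s < count_mem false s)%N.
Proof.
case/lastP: s => // s x _; rewrite last_rcons ballot_rcons => /andP[/ballot_count s_le _].
by case: x => // _; rewrite -cats1 !count_cat /= !addn0 addn1.
Qed.

(** Induction on the number of missing letters: [completionsS] branches on the next letter just as
    [after_up_rec] and [after_down_rec] do. *)
Lemma completionsE s l :
  (0 < size s)%N -> (size s + l = 2 * n)%N -> ballot s -> (count_mem false s <= n)%N ->
  completions s l = dyck_weight s *
   (if last false s then after_down a b t n (count_mem false s) (count_mem true s)
    else after_up a b t n (count_mem false s) (count_mem true s)).
Proof.
elim: l s => [|l IHl] s s_gt0 size_s s_ballot s_n.
  have := ballot_count s_ballot; have := count_letters s => z_o o_z.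
  have z_n : count_mem false s = n by lia.
  have o_n : count_mem true s = n by lia.
  rewrite completions0 /is_dyck z_n o_n eqxx -/(ballot s) s_ballot /=.
  by rewrite after_down_end // after_up_end // if_same mulr1.
have o_z := ballot_count s_ballot; have z_o := count_letters s.
have up_z := ballot_last_up s_gt0 s_ballot.
have count_rcons (x y : bool) : count_mem x (rcons s y) = (count_mem x s + (y == x))%N.
  by rewrite -cats1 count_cat /= addn0.
rewrite completionsS.
have -> : completions (rcons s true) l =
    if (count_mem true s < count_mem false s)%N
    then dyck_weight s * after_down a b t n (count_mem false s) (count_mem true s).+1
    else 0.
  case: ifPn => o_lt_z; last by rewrite completions_out // ballot_rcons s_ballot addn0 addn1 o_lt_z.
  rewrite IHl ?size_rcons ?ballot_rcons ?s_ballot ?count_rcons ?addn0 ?addn1 //=; try lia.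
  by rewrite last_rcons dyck_weight_rcons andbF mulr1.
have -> : completions (rcons s false) l =
    if (count_mem false s < n)%N
    then dyck_weight (rcons s false) * after_up a b t n (count_mem false s).+1 (count_mem true s)
    else 0.
  case: ifPn => z_lt_n; last first.
    by rewrite completions_out // count_rcons addn1 ltnS leqNgt z_lt_n orbT.
  rewrite IHl ?size_rcons ?ballot_rcons ?s_ballot ?count_rcons ?addn0 ?addn1 ?(leqW o_z) //=; try lia.
  by rewrite last_rcons.
rewrite dyck_weight_rcons andbT; case: (last false s) up_z => [_|/(_ isT) o_lt_z].
  case: (ltnP (count_mem false s) n) => z_n; last first.
    by rewrite !after_down_end // ifT ?add0r //; lia.
  rewrite [X in _ = _ * X]after_down_rec // mulrDr -mulrA; congr (_ + _).
  case: ltnP => // z_le_o; have -> : count_mem true s = count_mem false s by lia.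
  by rewrite after_down_out // mulr0.
rewrite o_lt_z; case: (ltnP (count_mem false s) n) => z_n; last first.
  by rewrite add0r after_down_end // after_up_end.
by rewrite /= mulr1 [X in _ = _ * X]after_up_rec // mulrDr.
Qed.

Lemma sum_dyck_paths : (0 < n)%N ->
  \sum_(P in dyck_paths n) dyck_weight P = (walk a b t 1 n.-1 1)`_0.
Proof.
move=> n_gt0; transitivity (completions [::] (2 * n)).
  by apply: eq_bigl => P; rewrite inE.
rewrite (_ : (2 * n)%N = (2 * n).-1.+1); last by lia.
(* The first letter must be 0; after it [z = 1], [o = 0] and no rise is undecided. *)
rewrite completionsS [X in _ + X]completions_out // addr0 completionsE //=; last by lia.
rewrite /after_up /rises big_geq // subn1.
by rewrite /dyck_weight /dyck_alpha /dyck_beta /des /Des /= !big_nil !expr0 !mul1r.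
Qed.

End Words.

(** * Translation back to the polynomials *)

Lemma dyck_polyE n : (0 < n)%N -> dyck_poly n = (walk va vb vt 1 n.-1 1)`_0.
Proof. by move=> n_gt0; rewrite -sum_dyck_paths. Qed.

Lemma dyck_poly0 : dyck_poly 0 = 1.
Proof.
rewrite /dyck_poly (eq_bigl (pred1 [tuple])); last first.
  by move=> P; rewrite (tuple0 P) inE; apply/esym/eqxx.
by rewrite big_pred1_eq /dyck_alpha /dyck_beta /des /Des /= !big_nil !expr0 !mul1r.
Qed.

Lemma dyck_poly_at_shift m k : (0 < m)%N ->
  dyck_poly_at m ((va * vb) ^+ k * vt) = (walk va vb vt k.+1 m.-1 1)`_0.
Proof.
move=> m_gt0; rewrite /dyck_poly_at dyck_polyE // walk_morph {1}/va {1}/vb {1}/vt.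
by rewrite /= !comp_mpolyXU !inordK //= walk_shift muln0 mul1r.
Qed.

Theorem theorem3p2 (n : nat) (hn : (1 <= n)%N) :
  dyck_poly n =
    dyck_poly (n - 1)
    + va ^+ (n - 1) * vt *
      \sum_(1 <= k < n)
        vb ^+ k * dyck_poly k * dyck_poly_at (n - k - 1) ((va * vb) ^+ k * vt).
Proof.
case: n hn => // -[_|n _].
  by rewrite big_geq // mulr0 addr0 dyck_poly0 dyck_polyE //= coef1.
rewrite subn1 !dyck_polyE // [LHS]walk_return; congr (_ + _ * _).
rewrite !big_seq; apply: eq_bigr => k; rewrite mem_index_iota => /andP[k_gt0 k_n].
rewrite dyck_polyE //; congr (_ * _).
(* At [k = n.+1] the last factor is C_0, outside the reach of [dyck_polyE]; it equals 1, as does the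
   empty inner walk. *)
case: (ltnP k n.+1) => k_lt_n.
  by rewrite dyck_poly_at_shift; [congr (walk _ _ _ _ _ _)`_0 | ]; lia.
have -> : (n.+2 - k - 1 = 0)%N by lia.
have -> : (n.+1 - k).-1 = 0%N by lia.
by rewrite /dyck_poly_at dyck_poly0 rmorph1 coef1.
Qed.
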